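(* Let $d\ge 2$ and let $T$ be a $d$-ary tree with $n$ leaves and $\operatorname{int}(T)$ internal vertices. Then $$\det\Big(\frac{1}{d-1}I+C(T)\Big)=(-1)^n\Gamma_T\Big(-\frac{1}{d-1}\Big)=(d-1)^{-n}d^{d(n-1)/(d-1)},$$ where $\Gamma_T(x)=\det(xI-C(T))$; equivalently, $$\det\big(I+(d-1)C(T)\big)=d^{d\operatorname{int}(T)}.$$ In particular, a binary tree ($d=2$) with $n$ leaves has exactly $4^{n-1}$ edge-disjoint collections of upward paths, independently of its shape.
   Context: A rooted tree $T$ has a distinguished vertex $r$, the root; the level $\ell(v)$ of a vertex $v$ is its distance from $r$. A leaf is a vertex without children (the root counts as a leaf only if it is the only vertex); internal vertices are the non-leaves. For vertices $v,w$, $v\vee w$ denotes the common ancestor of $v$ and $w$ farthest from the root (every vertex is an ancestor of itself). If $v_1,\ldots,v_n$ are the leaves, the ancestral matrix $C(T)$ is the $n\times n$ matrix with $(i,j)$ entry $\ell(v_i\vee v_j)$. A $d$-ary tree is a rooted tree in which every internal vertex has exactly $d$ children (a single vertex counts as a $d$-ary tree). An upward path from a leaf is a path starting at that leaf and moving only towards the root, possibly trivial (no edges). A collection of upward paths consists of one upward path from each leaf; it is edge-disjoint if no two of its paths share an edge. *)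

(* Defs.v *)
From mathcomp Require Import all_boot all_order all_algebra.

Set Implicit Arguments.
Unset Strict Implicit.
Unset Printing Implicit Defensive.

Import GRing.Theory.

Record rooted_tree (V : finType) := RootedTree {
  tree_edge : rel V;
  tree_root : V;
  tree_edge_sym : symmetric tree_edge;
  tree_edge_irr : irreflexive tree_edge;
  tree_connected : forall x y, connect tree_edge x y;
  (* an edge traversed back and forth is a [ucycle] of size 2 *)
  tree_acyclic : forall c : seq V, ucycle tree_edge c -> size c <= 2
}.

Section RootedTree.
Variables (V : finType) (T : rooted_tree V).
Implicit Types x y u v w : V.

Lemma walk_exists x y :
  exists k, [exists p : k.-tuple V, path (tree_edge T) x p && (last x p == y)].
Proof.
have /connectP[p ep ->] := tree_connected T x y.
by exists (size p); apply/existsP; exists (in_tuple p); rewrite ep /=.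
Qed.

Definition tree_dist x y : nat := ex_minn (walk_exists x y).

Definition level v : nat := tree_dist (tree_root T) v.

Definition children u : {set V} := [set v | tree_edge T u v & level v == (level u).+1].

Definition leaves : {set V} := [set v | children v == set0].

Definition internals : {set V} := ~: leaves.

Definition ancestor u v : bool := connect (fun x y => y \in children x) u v.

(* The common ancestors of v and w form a chain, so the maximiser is unique. *)
Definition vjoin v w : V :=
  [arg max_(u > tree_root T | ancestor u v && ancestor u w) level u].

(* The leaves are listed by [v]; reordering them conjugates the matrix by a
   permutation matrix. *)
Definition ancestral_mx (R : nzRingType) n (v : n.-tuple V) : 'M[R]_n :=
  \matrix_(i, j) ((level (vjoin (tnth v i) (tnth v j)))%:R)%R.

Definition d_ary (d : nat) : Prop :=
  forall v, v \in internals -> #|children v| = d.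

(* [p] lists the vertices after the starting vertex [x]. *)
Definition upward_path x (p : seq V) : bool :=
  path (fun y z => y \in children z) x p.

Definition path_edges x (p : seq V) : seq {set V} :=
  [seq [set yz.1; yz.2] | yz <- zip (x :: p) p].

(* Levels strictly decrease along an upward path, so bounding the length of
   the paths by #|V| excludes none of them. *)
Definition path_collection : finType :=
  {ffun {v : V | v \in leaves} -> #|V|.-bseq V}.

Definition edge_disjoint_collections : {set path_collection} :=
  [set f : path_collection | [forall v, upward_path (val v) (f v)]
     & [forall v, forall w, (v != w) ==>
         [disjoint path_edges (val v) (f v) & path_edges (val w) (f w)]]].

End RootedTree.

(* Main.v *)
(* Let P be the matrix of the parent relation on the vertices, with the edges to
   the root dropped, Q = I - P, and S the leaf selection matrix (zero in the root
   column). Then the matrix L = S Q^-1 records the non-root ancestors of each leaf,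
   C(T) = L L^T, and by Sylvester's identity
     det (I + (d-1) C(T)) = det (Q^T Q + (d-1) S^T S),
   a grounded Laplacian. Gaussian elimination from the leaves up factors it as
   (I - P/d)^T D (I - P/d) with D = diag(d, ..., d, 1), the 1 sitting at the root.

   For the count, let s be the set of vertices whose edge to the parent is used.
   A collection amounts to a set s missing the root together with, for each
   internal u in s, the child in s through which the path using the edge above u
   arrives. The number of collections is therefore the sum over s of the products
   of the numbers of children in s of the internal u in s. Complementing s on the
   children of u shows that every internal vertex contributes 1 on average, so the
   sum is the number of sets s. *)

Require Import Defs.
From mathcomp Require Import all_boot all_order all_algebra.
From mathcomp Require Import fingroup perm ring.
From mathcomp Require Import reals exp.

Set Implicit Arguments.
Unset Strict Implicit.
Unset Printing Implicit Defensive.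

Import GRing.Theory Num.Theory.

(** * Parents, ancestors and levels *)

Section RootedTree.
Variables (V : finType) (T : rooted_tree V).
Local Notation r := (tree_root T).
Local Notation e := (tree_edge T).
Local Notation level := (level T).
Local Notation children := (children T).
Local Notation ancestor := (ancestor T).

Lemma tree_dist_walk x y :
  exists p, [/\ path e x p, last x p = y & size p = tree_dist T x y].
Proof.
rewrite /tree_dist; case: ex_minnP => k /existsP[p /andP[ep /eqP lp]] _.
by exists p; rewrite size_tuple.
Qed.

Lemma tree_dist_le x y p :
  path e x p -> last x p = y -> tree_dist T x y <= size p.
Proof.
move=> ep lp; rewrite /tree_dist; case: ex_minnP => k _; apply.
by apply/existsP; exists (in_tuple p); rewrite ep lp /=.
Qed.

Lemma level_root : level r = 0.
Proof. by apply/eqP; rewrite -leqn0; apply: (@tree_dist_le r r [::]). Qed.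

Lemma level_eq0 v : (level v == 0) = (v == r).
Proof.
apply/eqP/eqP => [|->]; last exact: level_root.
by have [[|x p] [_ lp sp]] := tree_dist_walk r v; rewrite /Defs.level -sp.
Qed.

Lemma level_edge u v : e u v -> level v <= (level u).+1.
Proof.
move=> euv; have [p [ep lp sp]] := tree_dist_walk r u.
by rewrite /Defs.level -sp -(size_rcons p v) tree_dist_le ?last_rcons // rcons_path ep lp.
Qed.

Lemma has_parent v : v != r -> exists u, v \in children u.
Proof.
move=> vr; have [p [ep lp sp]] := tree_dist_walk r v.
case/lastP: p => [|p x] in ep lp sp; first by rewrite -lp eqxx in vr.
move: ep; rewrite last_rcons in lp; rewrite {}lp rcons_path => /andP[ep epv].
exists (last r p); rewrite inE epv /= eqn_leq level_edge //=.
by rewrite -[X in _ < X]sp size_rcons ltnS tree_dist_le.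
Qed.

(** Climbing from parent to parent never raises the level. The bound on levels is what keeps the
    connecting path in [parent_unique] away from [v]. *)
Lemma connect_root_below k v : level v <= k ->
  connect [rel x y | [&& e x y, level x <= k & level y <= k]] v r.
Proof.
have [m] := ubnP (level v); elim: m v => // m IH v vm vk.
have [->//|vr] := eqVneq v r.
have [u] := has_parent vr; rewrite inE => /andP[euv /eqP lv].
rewrite lv in vm vk; apply: (@connect_trans _ _ u); last by rewrite IH // ltnW.
by apply: connect1; rewrite /= tree_edge_sym euv lv vk ltnW.
Qed.

(* Two parents of v would be joined by a path staying at levels at most that of
   the parents, hence avoiding v; closing it up at v yields a cycle. *)
Lemma parent_unique u w v : v \in children u -> v \in children w -> u = w.
Proof.
rewrite !inE => /andP[euv /eqP lu] /andP[ewv /eqP lw].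
apply/eqP; apply: contraT => uw.
have lwu : level w = level u by apply: succn_inj; rewrite -lw lu.
set k := level u in lu lwu.
pose e' := [rel x y | [&& e x y, level x <= k & level y <= k]].
have sym_e' : connect_sym e'.
  by apply: sym_connect_sym => x y /=; rewrite tree_edge_sym andbA andbAC -andbA.
have /connectP[p0 ep0 lp0] : connect e' u w.
  apply: connect_trans (@connect_root_below k u (leqnn k)) _.
  by rewrite sym_e' connect_root_below ?lwu.
case/shortenP: ep0 lp0 => p ep up _ lp.
have path_e q x : path e' x q -> path e x q && all (fun y => level y <= k) q.
  by elim: q x => //= y q IH x /andP[/and3P[-> _ ->] /IH].
have /andP[{}ep lep] := path_e _ _ ep.
have vp : v \notin u :: p.
  rewrite inE negb_or; apply/andP; split.
    by apply/eqP => vu; have := lu; rewrite vu => /n_Sn.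
  by apply/negP => /(allP lep); rewrite lu ltnn.
have /(@tree_acyclic _ T) : ucycle e (v :: u :: p).
  rewrite /ucycle cons_uniq vp up /= !andbT rcons_path ep -lp ewv andbT.
  by rewrite tree_edge_sym euv.
(* Acyclicity leaves only the empty [p], that is, [u = w]. *)
by case: p lp {ep up lep vp} => //= wu; rewrite wu eqxx in uw.
Qed.

(** The default makes the root its own parent, so iterates of [parent] stall there. *)
Definition parent v := odflt v [pick u | v \in children u].

Lemma children_parent u v : (v \in children u) = (v != r) && (u == parent v).
Proof.
have noroot w : r \notin children w by rewrite inE level_root andbF.
rewrite /parent; case: pickP => [w vw|none] /=.
  apply/idP/andP => [vu|[_ /eqP-> //]]; rewrite (parent_unique vu vw) eqxx.
  by split=> //; apply: contraTneq vu => ->; apply: noroot.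
have [->|/has_parent[w]] := eqVneq v r; last by move=> vw; have := none w; rewrite vw.
by rewrite (negbTE (noroot u)).
Qed.

Lemma parent_root : parent r = r.
Proof. by rewrite /parent; case: pickP => // w; rewrite inE level_root andbF. Qed.

Lemma level_parent v : v != r -> level v = (level (parent v)).+1.
Proof.
by move=> vr; have := children_parent (parent v) v; rewrite vr eqxx inE => /andP[_ /eqP].
Qed.

Lemma parent_neq v : v != r -> (v == parent v) = false.
Proof. by move=> /level_parent lv; apply/eqP => vp; move: lv; rewrite -vp => /n_Sn. Qed.

Lemma ancestor_rec u v : ancestor u v = (u == v) || (v != r) && ancestor u (parent v).
Proof.
apply/idP/orP => [|[/eqP->|/andP[vr uv]]]; last 2 first.
- exact: connect0.
- by apply: connect_trans uv (connect1 _); rewrite children_parent vr eqxx.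
case/connectP => p; case/lastP: p => [|p x] /=; first by move=> _ ->; left.
rewrite rcons_path last_rcons => /andP[up] /[swap] <-.
rewrite children_parent => /andP[vr /eqP<-]; right; rewrite vr.
by apply/connectP; exists p.
Qed.

Lemma tree_ind (P : V -> Prop) :
  P r -> (forall v, v != r -> P (parent v) -> P v) -> forall v, P v.
Proof.
move=> Pr IH v; have [m] := ubnP (level v); elim: m v => // m IHm v.
have [->//|vr] := eqVneq v r; rewrite level_parent // => vm.
by apply: IH => //; apply: IHm.
Qed.

Lemma ancestor_refl v : ancestor v v.
Proof. exact: connect0. Qed.

Lemma ancestor_root v : ancestor r v.
Proof.
elim/tree_ind: v => [|v vr IH]; first exact: connect0.
by rewrite ancestor_rec vr IH orbT.
Qed.

Lemma level_ancestor u v : ancestor u v -> level u <= level v.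
Proof.
elim/tree_ind: v => [|v vr IH]; rewrite ancestor_rec.
  by rewrite eqxx andFb orbF => /eqP->.
by rewrite vr (level_parent vr) => /predU1P[->|/IH/leqW//]; rewrite (level_parent vr).
Qed.

(** Both vertices lie on the unique upward walk from [v], along which the level decides the
    order. *)
Lemma ancestor_chain u w v :
  ancestor u v -> ancestor w v -> level u <= level w -> ancestor u w.
Proof.
elim/tree_ind: v => [|v vr IH]; rewrite ancestor_rec [ancestor w _]ancestor_rec.
  by rewrite eqxx !andFb !orbF => /eqP-> /eqP-> _; apply: connect0.
rewrite vr /= => uv /predU1P[->|wv]; first by rewrite ancestor_rec vr.
case/predU1P: uv => [->|/IH]; last exact.
by rewrite level_parent // ltnNge level_ancestor.
Qed.

(** By [ancestor_chain], every common ancestor lies above the deepest one. With [card_ancestors],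
    each entry of the ancestral matrix thus counts common non-root ancestors, whence the Gram form
    [ancestral_mxE]. *)
Lemma ancestor_vjoin u v w : ancestor u (vjoin T v w) = ancestor u v && ancestor u w.
Proof.
rewrite /vjoin; case: arg_maxnP => [|j /andP[jv jw] max_j].
  by rewrite !ancestor_root.
apply/idP/andP => [uj|[uv uw]]; first by split; apply: connect_trans uj _.
by apply: (ancestor_chain uv jv); apply: max_j; rewrite uv.
Qed.

Lemma card_ancestors v : #|[set u | (u != r) && ancestor u v]| = level v.
Proof.
elim/tree_ind: v => [|v vr IH].
  rewrite level_root; apply: eq_card0 => u; rewrite inE ancestor_rec eqxx orbF.
  by case: (u == r).
rewrite level_parent // -IH -add1n.
have vA : v \notin [set u | (u != r) && ancestor u (parent v)].
  rewrite inE vr; apply/negP => /level_ancestor.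
  by rewrite (level_parent vr) ltnn.
rewrite -[1]/(nat_of_bool true) -vA -cardsU1; apply: eq_card => u.
rewrite !inE ancestor_rec vr /=; case: (eqVneq u v) => // ->.
by rewrite vr.
Qed.
End RootedTree.

(** * The determinant *)

Section Determinants.
Local Open Scope ring_scope.
Variable R : comNzRingType.

(* If the term of a permutation s does not vanish, then f (s i) <= f i for all
   i, and summing over i forces equality everywhere. *)
Lemma det_graded n (A : 'M[R]_n) (f : 'I_n -> nat) :
  (forall i j, A i j != 0 -> i = j \/ (f j < f i)%N) -> \det A = \prod_i A i i.
Proof.
move=> fA; rewrite /determinant (bigD1 (1%g : {perm 'I_n})) //= odd_perm1 expr0 mul1r.
rewrite [X in _ + X]big1 ?addr0 => [|s s1]; first by apply: eq_bigr => i _; rewrite perm1.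
have [i /eqP Ai0|nz] := pickP (fun i => A i (s i) == 0).
  by rewrite (bigD1 i) //= Ai0 mul0r mulr0.
have le_f i : (f (s i) <= f i)%N.
  by case: (fA i (s i) (negbT (nz i))) => [<-|/ltnW].
have [i si|s_id] := pickP (fun i => s i != i); last first.
  by case/eqP: s1; apply/permP => i; rewrite perm1; apply/eqP/negPn; rewrite s_id.
have: (\sum_i f (s i) < \sum_i f i)%N.
  rewrite (bigD1 i) // [ltnRHS](bigD1 i) //= -addSn leq_add ?leq_sum //.
  by case: (fA i (s i) (negbT (nz i))) => // ii; rewrite -ii eqxx in si.
by rewrite [ltnRHS](reindex_inj (@perm_inj _ s)) ltnn.
Qed.

(** Sylvester's identity: one block row operation of determinant 1 makes [M] lower triangular,
    another makes it upper triangular. *)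
Lemma det_1Dmul m n (A : 'M[R]_(m, n)) (B : 'M_(n, m)) :
  \det (1%:M + A *m B) = \det (1%:M + B *m A).
Proof.
pose M := block_mx 1%:M (- A) B 1%:M.
transitivity (\det M).
  transitivity (\det (block_mx 1%:M A 0 1%:M *m M)).
    rewrite mulmx_block !mul1mx !mul0mx mulmx1 !add0r addNr det_lblock det1 mulr1.
    by [].
  by rewrite det_mulmx det_ublock !det1 !mul1r.
transitivity (\det (block_mx 1%:M 0 (- B) 1%:M *m M)).
  by rewrite det_mulmx det_lblock !det1 !mul1r.
rewrite mulmx_block !mul1mx !mul0mx mulmx1 !addr0 addNr det_ublock det1 mul1r.
by rewrite mulmxN mulNmx opprK addrC.
Qed.

Lemma horner_char_poly n (A : 'M[R]_n) x : (char_poly A).[x] = \det (x%:M - A).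
Proof.
rewrite -/(horner_eval x _) -det_map_mx; congr (\det _).
by apply/matrixP => i j; rewrite !mxE; case: (i == j); rewrite /= /horner_eval !hornerE.
Qed.

Variable V : finType.

Definition vertex_mx (f : V -> V -> R) : 'M_#|V| :=
  \matrix_(i, j) f (enum_val i) (enum_val j).

Lemma sum_enum_val (F : V -> R) : \sum_(k < #|V|) F (enum_val k) = \sum_x F x.
Proof. by rewrite -big_enum_val. Qed.

Lemma vertex_mx1 : vertex_mx (fun x y => (x == y)%:R) = 1%:M.
Proof. by apply/matrixP => i j; rewrite !mxE (inj_eq enum_val_inj). Qed.

Lemma mul_vertex_mx f g :
  vertex_mx f *m vertex_mx g = vertex_mx (fun x y => \sum_z f x z * g z y).
Proof.
apply/matrixP => i j; rewrite !mxE -sum_enum_val.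
by apply: eq_bigr => k _; rewrite !mxE.
Qed.

End Determinants.

(** * Vertex and leaf counts of a d-ary tree *)

Section DAry.
Variables (V : finType) (T : rooted_tree V).
Local Notation r := (tree_root T).

(** Every vertex but the root is counted once, at its parent. *)
Lemma sum_card_children : \sum_u #|children T u| = #|V|.-1.
Proof.
transitivity (\sum_u \sum_v ((v != r) && (u == parent T v) : nat)).
  apply: eq_bigr => u _; rewrite -sum1_card big_mkcond /=.
  by apply: eq_bigr => v _; rewrite children_parent; case: ifP.
rewrite exchange_big /= -(cardC1 r) -sum1_card [RHS]big_mkcond /=.
apply: eq_bigr => v _; rewrite inE; case: eqVneq => _ /=.
  by rewrite big1.
by rewrite (bigD1 (parent T v)) //= eqxx big1 // => u /negbTE->.
Qed.

Variable d : nat.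
Hypothesis hT : d_ary T d.

Lemma card_childrenE u : #|children T u| = (u \in internals T) * d.
Proof.
case: (boolP (u \in internals T)) => [/hT->|]; first by rewrite mul1n.
by rewrite !inE negbK => /eqP->; rewrite cards0.
Qed.

Lemma card_vertices : #|V|.-1 = d * #|internals T|.
Proof.
rewrite -sum_card_children (eq_bigr _ (fun u _ => card_childrenE u)).
by rewrite -big_distrl /= -sum1_card mulnC [in RHS]big_mkcond.
Qed.
End DAry.

(** A deepest vertex is a leaf. *)
Lemma leaves_gt0 (V : finType) (T : rooted_tree V) : 0 < #|leaves T|.
Proof.
case: (@arg_maxnP V (tree_root T) predT (level T) isT) => u _ max_u.
apply/card_gt0P; exists u; rewrite inE; apply/eqP/setP => w; rewrite !inE.
by apply/negP => /andP[_ /eqP lw]; have := max_u w isT; rewrite /= lw ltnn.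
Qed.

Lemma card_leaves (V : finType) (T : rooted_tree V) d :
  0 < d -> d_ary T d -> #|leaves T|.-1 = d.-1 * #|internals T|.
Proof.
case: d => // d _ /card_vertices; rewrite -(cardsC (leaves T)) -/(internals T).
case: #|leaves T| (leaves_gt0 T) => // l _ /=.
by rewrite mulSn addnC => /addnI.
Qed.

(** * The determinant of the scaled ancestral matrix *)

Section TreeDeterminant.
Local Open Scope ring_scope.
Variables (F : fieldType) (V : finType) (T : rooted_tree V).
Variables (n : nat) (v : n.-tuple V).
Local Notation r := (tree_root T).

Let parent_mx : 'M[F]_#|V| :=
  vertex_mx (fun x y => ((y != r) && (x \in children T y))%:R).

Let leaf_mx : 'M[F]_(n, #|V|) :=
  \matrix_(i, k) ((enum_val k == tnth v i) && (enum_val k != r))%:R.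

(** The sum of all powers of [parent_mx]. The disjunct [x == y] is the power 0, which also
    contributes the diagonal entry at the root. *)
Let ancestor_mx : 'M[F]_#|V| :=
  vertex_mx (fun x y => ((x == y) || (y != r) && ancestor T y x)%:R).

(** Removing from the ancestors of [x] those of its parent leaves [x] alone. *)
Lemma parent_ancestor_mx : (1%:M - parent_mx) *m ancestor_mx = 1%:M.
Proof.
rewrite mulmxBl mul1mx mul_vertex_mx -vertex_mx1.
apply/matrixP => i j; rewrite !mxE.
move: (enum_val i) (enum_val j) => x y.
rewrite (bigD1 (parent T x)) //= big1 ?addr0 => [|z zx]; last first.
  by rewrite children_parent (negbTE zx) !andbF mul0r.
rewrite children_parent eqxx andbT -natrM mulnb.
have [->|xy] := eqVneq x y.
  have [->|yr] := eqVneq y r; first by rewrite parent_root eqxx subr0.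
  rewrite [_ == y]eq_sym (parent_neq yr).
  case: (ancestor T y (parent T y)) / boolP => [/level_ancestor|_].
    by rewrite (level_parent yr) ltnn.
  by rewrite !andbF subr0.
rewrite [ancestor T y x]ancestor_rec [y == x]eq_sym (negbTE xy) /=.
have [->|xr] := eqVneq x r; first by rewrite !andbF subrr.
have [->|pr] /= := eqVneq (parent T x) r.
  rewrite ancestor_rec eqxx orbF; case: eqVneq => //; by rewrite subrr.
case: (eqVneq (parent T x) y) => [<-|_]; last by rewrite subrr.
by rewrite pr ancestor_refl subrr.
Qed.

Lemma ancestor_parent_mx : ancestor_mx *m (1%:M - parent_mx) = 1%:M.
Proof. exact: mulmx1C parent_ancestor_mx. Qed.

Lemma leaf_ancestor_mxE i k : (leaf_mx *m ancestor_mx) i k =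
  ((enum_val k != r) && ancestor T (enum_val k) (tnth v i))%:R.
Proof.
rewrite mxE; under eq_bigr do rewrite !mxE.
rewrite (sum_enum_val (fun z => ((z == tnth v i) && (z != r))%:R *
  ((z == enum_val k) || (enum_val k != r) && ancestor T (enum_val k) z)%:R)).
rewrite (bigD1 (tnth v i)) //= big1 ?addr0 => [|z /negbTE->]; last by rewrite mul0r.
rewrite eqxx -natrM mulnb /=; move: (enum_val k) => y.
have [->|xr] /= := eqVneq (tnth v i) r.
  by rewrite ancestor_rec eqxx orbF; case: eqVneq.
by case: eqVneq => // <-; rewrite xr ancestor_refl.
Qed.

Lemma ancestral_mxE :
  ancestral_mx T F v = (leaf_mx *m ancestor_mx) *m (leaf_mx *m ancestor_mx)^T.
Proof.
apply/matrixP => i j; rewrite mxE [RHS]mxE -card_ancestors.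
under [RHS]eq_bigr do rewrite [_^T _ _]mxE !leaf_ancestor_mxE -natrM mulnb.
rewrite (sum_enum_val (fun z => ((z != r) && ancestor T z (tnth v i) &&
  ((z != r) && ancestor T z (tnth v j)))%:R)).
rewrite -natr_sum -sum1_card big_mkcond /=; congr (_%:R); apply: eq_bigr => z _.
by rewrite inE ancestor_vjoin andbACA andbb; case: ifP.
Qed.

(** Unitriangular with respect to the level. Used for [c = 1] and for [c = d^-1]. *)
Lemma det_1B_parent_mx c : \det (1%:M - c *: parent_mx) = 1.
Proof.
have diag i : (1%:M - c *: parent_mx) i i = 1.
  rewrite !mxE eqxx children_parent; set x := enum_val i.
  have [->|xr] := eqVneq x r; first by rewrite !andbF mulr0 subr0.
  by rewrite parent_neq // mulr0 subr0.
rewrite (det_graded (f := fun i => level T (enum_val i))) ?big1 // => i j.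
have [->|ij] := eqVneq i j; first by left.
rewrite !mxE (negbTE ij) children_parent.
have [xr|xr] := eqVneq (enum_val i) r; first by rewrite andbF mulr0 subrr eqxx.
have [->|] := eqVneq (enum_val j) (parent T (enum_val i)); last first.
  by rewrite !andbF mulr0 subrr eqxx.
by right; rewrite [ltnRHS]level_parent.
Qed.

Hypotheses (v_uniq : uniq v) (v_leaves : v =i leaves T).

Lemma leaf_mxTmul : leaf_mx^T *m leaf_mx =
  vertex_mx (fun x y => [&& x == y, x != r & x \in leaves T]%:R).
Proof.
apply/matrixP => i j; rewrite !mxE; under eq_bigr do rewrite !mxE -natrM mulnb.
move: (enum_val i) (enum_val j) => x y.
rewrite -(big_tuple 0 +%R v xpredT (fun w =>
  ((x == w) && (x != r) && ((y == w) && (y != r)))%:R)).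
rewrite -v_leaves; have [xv|xv] := boolP (x \in v); last first.
  rewrite !andbF big_seq big1 // => w wv.
  by case: eqVneq => // xw; rewrite xw wv in xv.
rewrite (bigD1_seq x) //= big1 ?addr0 => [|w /negbTE wx]; last by rewrite eq_sym wx.
rewrite eqxx andbT [y == x]eq_sym /=.
by case: (eqVneq x y) => [->|]; rewrite ?andbb ?andbF.
Qed.

Variable d : nat.
Hypotheses (hT : d_ary T d) (d_neq0 : d%:R != 0 :> F).

Let pivot_mx : 'M[F]_#|V| :=
  vertex_mx (fun x y => (x == y)%:R * (if x == r then 1 else d%:R)).

Lemma det_pivot_mx : \det pivot_mx = d%:R ^+ #|V|.-1.
Proof.
rewrite (det_graded (f := fun=> 0)) => [|i j]; last first.
  rewrite mxE (inj_eq enum_val_inj).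
  case: (eqVneq i j) => [|_]; [by left | by rewrite /= mul0r eqxx].
under eq_bigr do rewrite mxE eqxx mul1r.
rewrite -(big_enum_val (fun x : V => if x == r then 1 else d%:R : F)) /=.
rewrite (bigD1 r) //= eqxx mul1r -(cardC1 r) -prodr_const.
by apply: eq_bigr => x /negbTE->.
Qed.

(* Gaussian elimination from the leaves upwards; every pivot other than the one
   at the root equals d. *)
Lemma parent_mx_pivot :
  (1%:M - parent_mx)^T *m (1%:M - parent_mx) + (d%:R - 1) *: (leaf_mx^T *m leaf_mx)
  = (1%:M - d%:R^-1 *: parent_mx)^T *m pivot_mx *m (1%:M - d%:R^-1 *: parent_mx).
Proof.
(* The root row of [parent_mx] vanishes, so only pivots equal to [d] are met. *)
have PD : pivot_mx *m parent_mx = d%:R *: parent_mx.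
  rewrite mul_vertex_mx; apply/matrixP => i j; rewrite !mxE.
  move: (enum_val i) (enum_val j) => x y.
  rewrite (bigD1 x) //= big1 ?addr0 => [|z]; last first.
    by rewrite eq_sym => /negbTE->; rewrite !mul0r.
  rewrite eqxx mul1r children_parent; case: eqVneq => // _.
  by rewrite andbF !mulr0.
have DP : parent_mx^T *m pivot_mx = d%:R *: parent_mx^T.
  have <- : pivot_mx^T = pivot_mx.
    apply/matrixP => i j; rewrite !mxE !(inj_eq enum_val_inj) [j == i]eq_sym.
    by case: (eqVneq i j) => [->|_]; rewrite /= ?mul0r.
  by rewrite -trmx_mul PD linearZ.
(* Distinct vertices share no child, so this product is diagonal and counts children. *)
have PP : parent_mx^T *m parent_mx = vertex_mx (fun x y =>
    (x == y)%:R * ((x != r) && (x \in internals T))%:R * d%:R).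
  apply/matrixP => i j; rewrite !mxE; under eq_bigr do rewrite !mxE -natrM mulnb.
  move: (enum_val i) (enum_val j) => x y.
  rewrite (sum_enum_val (fun z => (((x != r) && (z \in children T x)) &&
    ((y != r) && (z \in children T y)))%:R)).
  have [<-|xy] := eqVneq x y; last first.
    rewrite big1 ?mul0r // => z _.
    case: (boolP (z \in children T x)) => zx; last by rewrite andbF.
    case: (boolP (z \in children T y)) => zy; last by rewrite !andbF.
    by rewrite (parent_unique zx zy) eqxx in xy.
  rewrite -natr_sum mul1r -natrM; congr (_%:R).
  under eq_bigr do rewrite andbb.
  case: eqVneq => [_|_] /=; first by rewrite big1.
  rewrite -(card_childrenE hT) -sum1_card [RHS]big_mkcond.
  by apply: eq_bigr => z _; case: ifP.
have trB c : (1%:M - c *: parent_mx)^T = 1%:M - c *: parent_mx^T.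
  by rewrite linearB linearZ /= trmx1.
rewrite -{1 2}[parent_mx]scale1r !trB !scale1r.
rewrite !(mulmxBl, mulmxBr) !(mulmx1, mul1mx).
rewrite -!scalemxAl -!scalemxAr DP PD -scalemxAl !scalerA PP leaf_mxTmul.
rewrite mulVf // mulr1 !scale1r.
apply/matrixP => i j; rewrite -vertex_mx1 !mxE.
move: (enum_val i) (enum_val j) => x y; rewrite !inE.
(* Besides the terms linear in [parent_mx] and its transpose, common to both sides, the rest is
   diagonal: 1 at the root, [d + 1] at other internal vertices, [d] at other leaves. *)
have [<-|_] := eqVneq x y; last by rewrite /= !(mul0r, mulr0); ring.
have [_|_] /= := eqVneq x r; first by rewrite !(mul0r, mulr0, mul1r); ring.
by case: (children T x == set0) => /=; field.
Qed.

Lemma det_ancestral_mx :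
  \det (1%:M + (d%:R - 1) *: ancestral_mx T F v) = d%:R ^+ #|V|.-1.
Proof.
rewrite ancestral_mxE scalemxAl det_1Dmul -scalemxAr.
set L := leaf_mx *m ancestor_mx; set Q := 1%:M - parent_mx.
have detQ : \det Q = 1 by rewrite -(det_1B_parent_mx 1) scale1r.
have LQ : L *m Q = leaf_mx by rewrite -mulmxA ancestor_parent_mx mulmx1.
have := parent_mx_pivot; rewrite -/Q; move: Q L detQ LQ => Q L detQ LQ pivot.
(* Multiplying by [Q^T] and [Q], of determinant 1, turns [L] into [leaf_mx], so that
   [parent_mx_pivot] applies. *)
transitivity (\det (Q^T *m (1%:M + (d%:R - 1) *: (L^T *m L)) *m Q)).
  by rewrite !det_mulmx det_tr detQ mul1r mulr1.
have -> : Q^T *m (1%:M + (d%:R - 1) *: (L^T *m L)) *m Q =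
    Q^T *m Q + (d%:R - 1) *: ((L *m Q)^T *m (L *m Q)).
  by rewrite trmx_mul mulmxDr mulmxDl mulmx1 -scalemxAr -scalemxAl !mulmxA.
rewrite LQ pivot !det_mulmx det_tr det_1B_parent_mx.
by rewrite mul1r mulr1 det_pivot_mx.
Qed.
End TreeDeterminant.

(** * Edge-disjoint collections *)

Section Selectors.
Variables (V : finType) (T : rooted_tree V).
Local Notation r := (tree_root T).
Hypothesis binary : d_ary T 2.

Lemma root_notin_children u : r \notin children T u.
Proof. by rewrite children_parent eqxx. Qed.

Let weight (s : {set V}) u := if u \in s then #|children T u :&: s| else 1.

(* Complementing s on the children of a deepest vertex u of U preserves the
   weights of the other vertices of U, and the two weights of u add up to 2. *)
Lemma sum_prod_weight (U : {set V}) : U \subset internals T ->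
  \sum_(s : {set V} | r \notin s) \prod_(u in U) weight s u = 2 ^ #|V|.-1.
Proof.
have [m] := ubnP #|U|; elim: m U => // m IH U Um UI.
have [->|[u0 u0U]] := set_0Vmem U.
  under eq_bigr do rewrite big_set0.
  rewrite sum1_card -(cardsC1 r) -card_powerset; apply: eq_card => s.
  rewrite !inE; apply/idP/subsetP => [rs x xs|sr].
    by rewrite !inE; apply: contraNneq rs => <-.
  by apply/negP => /sr; rewrite !inE eqxx.
case: (arg_maxnP (level T) u0U) => u uU max_u {u0 u0U}.
have {}uU : u \in U := uU.
pose flip (s : {set V}) := [set x | (x \in s) (+) (x \in children T u)].
have flipK : involutive flip.
  by move=> s; apply/setP => x; rewrite !inE -addbA addbb addbF.
have flip_out s x : x \notin children T u -> (x \in flip s) = (x \in s).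
  by rewrite [x \in flip s]inE => /negbTE->; rewrite addbF.
(* No vertex of [U] is deeper than [u], so [flip] does not affect membership of the vertices of [U]
   in [s]. *)
have U_out w : w \in U -> w \notin children T u.
  by move=> /max_u /= lw; rewrite inE negb_and neq_ltn ltnS lw orbT.
have flip_weight s w : w \in U :\ u -> weight (flip s) w = weight s w.
  rewrite !inE => /andP[wu wU]; rewrite /weight flip_out ?U_out //.
  case: ifP => // _; apply: eq_card => x; rewrite in_setI [RHS]in_setI.
  case: (boolP (x \in children T w)) => //= xw; apply: flip_out.
  by apply: contraNN wu => xu; rewrite (parent_unique xw xu).
have weight_u s : weight s u + weight (flip s) u = 2.
  rewrite /weight flip_out ?U_out //; case: ifP => // _.
  rewrite -(binary (subsetP UI _ uU)) -(cardsID s (children T u)); congr (_ + _).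
  apply: eq_card => x; rewrite in_setI in_setD [x \in flip s]inE.
  by case: (x \in children T u); case: (x \in s).
have prodU s : \prod_(w in U) weight s w = weight s u * \prod_(w in U :\ u) weight s w.
  by rewrite (big_setD1 u).
(* The claim is doubled in order to add the sum to its reindexing along [flip]. *)
apply/eqP; rewrite -(eqn_pmul2l (isT : 0 < 2)) -(IH (U :\ u)); last 2 first.
- by move: Um; rewrite (cardsD1 u) uU.
- by apply: subset_trans UI; apply: subsetDl.
rewrite mul2n -addnn [X in _ + X](reindex_inj (inv_inj flipK)) /=.
under [X in _ + X]eq_bigl do rewrite flip_out ?root_notin_children //.
rewrite -big_split big_distrr /=; apply/eqP/eq_bigr => s _.
rewrite !prodU [X in _ + _ * X](eq_bigr (weight s)) => [|w]; last exact: flip_weight.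
by rewrite -mulnDl weight_u.
Qed.

(** At a leaf, the leaf itself is the token for its own path taking the edge above it. *)
Definition candidates (s : {set V}) u : {set V} :=
  if u \in leaves T then [set u] else children T u :&: s.

(** One function encodes both data: its support is the set of vertices whose edge to the parent is
    used, and [h u = Some c] says that the path using the edge above [u] arrives through [c]. *)
Definition selectors : {set {ffun V -> option V}} :=
  [set h : {ffun V -> option V} | (h r == None) && [forall u, forall c,
    (h u == Some c) ==> (c \in candidates [set x | h x] u)]].

(** For a fixed support [s] the choices are independent. Leaves contribute a factor 1 and internal
    vertices their weight, so [sum_prod_weight] applies. *)
Lemma card_selectors : #|selectors| = 4 ^ #|internals T|.
Proof.
have -> : 4 ^ #|internals T| = 2 ^ #|V|.-1.
  by rewrite (card_vertices binary) expnM.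
rewrite -(sum_prod_weight (subxx _)) -sum1_card.
pose supp (h : {ffun V -> option V}) := [set x | h x].
rewrite (partition_big supp (fun s => r \notin s)) /= => [|h]; last first.
  by rewrite !inE => /andP[/eqP->].
apply: eq_bigr => s rs; rewrite sum1_card.
transitivity #|pfamily None (mem s) (fun x => mem (Some @: candidates s x))|.
  apply: eq_card => h; rewrite -[LHS]/((h \in selectors) && (supp h == s)) inE.
  apply/idP/pfamilyP.
    case/andP=> /andP[_ /forallP hP] /eqP hs; split.
      by apply/subsetP => x; rewrite -hs !inE; case: (h x).
    move=> x; rewrite -hs inE => hx; move: (hP x); rewrite -/(supp h) hs.
    case: (h x) hx => // c _ /forallP /(_ c); rewrite eqxx => /= cx.
    exact: imset_f.
  case=> /subsetP hs hP.
  have supps : supp h = s.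
    apply/setP => x; rewrite inE; apply/idP/idP => [hx|/hP /imsetP[c _ ->] //].
    by apply: hs; rewrite inE; case: (h x) hx.
  rewrite -/(supp h) supps eqxx andbT; apply/andP; split.
    by case: (h r =P None) => // hr; case/negP: rs; apply: hs; rewrite inE; apply/eqP.
  apply/'forall_forallP => x c; apply/implyP => /eqP hx.
  have: x \in s by rewrite -supps inE hx.
  by move/hP; rewrite hx => /imsetP[y yc [->]].
rewrite card_pfamily foldrE big_image /= [RHS]big_mkcond [LHS]big_mkcond /=.
apply: eq_bigr => x _; rewrite card_imset; last by move=> ? ? [].
rewrite /candidates /weight !inE; case: ifP => _; case: ifP => //= _; exact: cards1.
Qed.
End Selectors.

Lemma card_eq_can_in (aT rT : finType) (A : {set aT}) (B : {set rT})
    (f : aT -> rT) (g : rT -> aT) :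
  {in A, forall x, f x \in B} -> {in B, forall y, g y \in A} ->
  {in A, cancel f g} -> {in B, cancel g f} -> #|A| = #|B|.
Proof.
move=> fB gA fK gK; rewrite -(card_in_imset (can_in_inj fK)).
apply: eq_card => y; apply/imsetP/idP => [[x /fB ? ->//]|yB].
by exists (g y); rewrite ?gK ?gA.
Qed.

(** * The bijection between edge-disjoint collections and selectors *)

Section Collections.
Variables (V : finType) (T : rooted_tree V).
Local Notation r := (tree_root T).
Local Notation par := (parent T).
Local Notation level := (level T).
Local Notation leaf := {v : V | v \in leaves T}.

Lemma level_iter_parent i v : level (iter i par v) = level v - i.
Proof.
elim: i => [|i IH] /=; first by rewrite subn0.
rewrite subnS -IH; have [->|vr] := eqVneq (iter i par v) r.
  by rewrite parent_root level_root.
by rewrite [in RHS]level_parent.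
Qed.

Lemma iter_parent_neq_root i v : i < level v -> iter i par v != r.
Proof. by rewrite -level_eq0 level_iter_parent subn_eq0 -ltnNge. Qed.

(** The bounds exclude the iterates that have stalled at the root. *)
Lemma iter_parent_inj i j v :
  i <= level v -> j <= level v -> iter i par v = iter j par v -> i = j.
Proof.
move=> iv jv /(congr1 level); rewrite !level_iter_parent => e.
by rewrite -(subKn iv) e subKn.
Qed.

Lemma iter_parent_leaf i v :
  i <= level v -> (iter i par v \in leaves T) -> i = 0.
Proof.
case: i => // i iv; rewrite inE => /eqP c0; have := in_set0 (iter i par v).
by rewrite -c0 /= children_parent iter_parent_neq_root // eqxx.
Qed.

(** An upward path is determined by its start and its length. *)
Lemma upward_pathP x p :
  reflect (p = traject par (par x) (size p) /\ size p <= level x)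
          (upward_path T x p).
Proof.
elim: p x => [|y p IH] x /=; first by apply: ReflectT.
rewrite children_parent; have [->|xr] /= := eqVneq x r.
  by apply: ReflectF => -[_]; rewrite level_root.
rewrite (level_parent xr) ltnS.
apply: (iffP andP) => [[/eqP-> /IH[<- ->]] //|[[-> pE] sp]].
by rewrite eqxx; split=> //; apply/IH; split.
Qed.

(** Otherwise [x] and [y] would be parents of each other. Edges can thus be named by their lower
    endpoints, as [edge_disjointP] does. *)
Lemma parent_edge_inj x y : x != r -> y != r ->
  [set x; par x] = [set y; par y] -> x = y.
Proof.
move=> xr yr /setP E; have := E x; have := E y.
rewrite !inE !eqxx /= [y == x]eq_sym; case: eqVneq => //= _ /eqP yp /esym/eqP xp.
have := level_parent xr; have := level_parent yr; rewrite -yp -xp => ->.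
by move=> /eqP; rewrite -[X in X == _]addn0 -addn2 eqn_add2l.
Qed.

Lemma path_edges_traject x k : path_edges x (traject par (par x) k) =
  [seq [set iter i par x; iter i.+1 par x] | i <- iota 0 k].
Proof.
rewrite /path_edges; elim: k x => //= k IH x; congr cons.
rewrite IH -[1]/(1 + 0) iotaDl -map_comp; apply: eq_map => i.
by rewrite /= -iterSr.
Qed.

Lemma edge_disjointP (f : path_collection T) :
  reflect [/\ forall v : leaf, f v = traject par (par (val v)) (size (f v)) :> seq V,
      forall v : leaf, size (f v) <= level (val v)
    & forall (v w : leaf) i j, i < size (f v) -> j < size (f w) ->
        iter i par (val v) = iter j par (val w) -> v = w]
    (f \in edge_disjoint_collections T).
Proof.
rewrite inE.
have disjE (v w : leaf) :
    upward_path T (val v) (f v) -> upward_path T (val w) (f w) ->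
  reflect (forall i j, i < size (f v) -> j < size (f w) ->
        iter i par (val v) <> iter j par (val w))
    [disjoint path_edges (val v) (f v) & path_edges (val w) (f w)].
  move=> /upward_pathP[-> sv] /upward_pathP[-> sw].
  rewrite size_traject in sv; rewrite size_traject in sw.
  rewrite !path_edges_traject !size_traject disjoint_has.
  have edge x k m : m < k -> [set iter m par x; iter m.+1 par x] \in
      [seq [set iter i par x; iter i.+1 par x] | i <- iota 0 k].
    by move=> mk; apply/mapP; exists m; rewrite ?mem_iota.
  apply: (iffP hasPn) => [dis i j iv jw ij|dis E].
    by case/negP: (dis _ (edge _ _ _ iv)); rewrite /= ij; apply: edge.
  case/mapP => i; rewrite mem_iota /= => iv ->; apply/negP => /mapP[j].
  rewrite mem_iota /= => jw /parent_edge_inj; rewrite !iter_parent_neq_root.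
  - by move=> /(_ isT isT); apply: dis.
  - exact: leq_trans jw sw.
  - exact: leq_trans iv sv.
apply: (iffP andP) => [[/forallP up /'forall_forallP dis]|[fE fl dis]].
  split=> [v|v|v w i j iv jw ij].
  - by have /upward_pathP[] := up v.
  - by have /upward_pathP[] := up v.
  - apply/eqP; apply: contraT => vw.
    by have /implyP/(_ vw)/(disjE _ _ (up v) (up w)) := dis v w; case/(_ i j iv jw).
have up (v : leaf) : upward_path T (val v) (f v).
  by apply/upward_pathP; split; rewrite ?fl // -fE.
split; first exact/forallP.
apply/'forall_forallP => v w; apply/implyP => /eqP vw.
by apply/(disjE _ _ (up v) (up w)) => i j iv jw /(dis _ _ _ _ iv jw).
Qed.

Lemma level_le_card v : level v <= #|V|.
Proof. by rewrite -card_ancestors max_card. Qed.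

(** The path from [v] climbs as long as [h] selects the vertex it comes from. Since [0.-1 = 0], the
    test at the start is [h v = Some v], the token of a leaf. *)
Definition steps (h : {ffun V -> option V}) v :=
  find (fun i => h (iter i par v) != Some (iter i.-1 par v)) (iota 0 (level v)).

Lemma steps_le h v : steps h v <= level v.
Proof. by rewrite -[leqRHS](size_iota 0) find_size. Qed.

(** As [h] is [None] at the root, a run of successful tests ends before [level v], so the search
    range in [steps] never cuts it short. *)
Lemma ltn_stepsP (h : {ffun V -> option V}) v i : h r = None ->
  reflect (forall j, j <= i -> h (iter j par v) = Some (iter j.-1 par v))
          (i < steps h v).
Proof.
move=> hr; apply: (iffP idP) => [iv j ji|hi].
  have jv := leq_ltn_trans ji iv; have /negbFE := before_find 0 jv.
  by rewrite nth_iota ?(leq_trans jv (steps_le h v)) // => /eqP.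
rewrite ltnNge; apply/negP => /hi hs.
have: steps h v < level v.
  rewrite ltnNge; apply/negP => sv; move: hs; rewrite (_ : iter _ _ _ = r) ?hr //.
  by apply/eqP; rewrite -level_eq0 level_iter_parent subn_eq0.
rewrite -[X in _ < X](size_iota 0) -has_find => hasP.
have := nth_find 0 hasP; rewrite -/(steps h v) nth_iota -?hs ?eqxx //.
by rewrite -[X in _ < X](size_iota 0) -has_find.
Qed.

(** Lengths are at most [level v], hence at most [#|V|], so [insub_bseq] never falls back on its
    default. *)
Definition collection_of (h : {ffun V -> option V}) : path_collection T :=
  [ffun v : leaf =>
    insub_bseq #|V| (traject par (par (val v)) (steps h (val v)))].

Lemma collection_ofE h (v : leaf) :
  collection_of h v = traject par (par (val v)) (steps h (val v)) :> seq V.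
Proof.
rewrite ffunE val_insubd size_traject.
by rewrite (leq_trans (steps_le _ _) (level_le_card _)).
Qed.

Definition selector_of (f : path_collection T) : {ffun V -> option V} :=
  [ffun u => [pick c | [exists v : leaf, [exists i : 'I_(size (f v)),
    (u == iter i par (val v)) && (c == iter i.-1 par (val v))]]]].

(** Edge-disjointness makes the path through the edge above [u] unique, so the [pick] has only one
    possible outcome. *)
Lemma selector_ofP f u c : f \in edge_disjoint_collections T ->
  selector_of f u = Some c <-> exists (v : leaf) i,
    [/\ i < size (f v), u = iter i par (val v) & c = iter i.-1 par (val v)].
Proof.
case/edge_disjointP => fE fl dis; rewrite ffunE; case: pickP => [c'|none].
  case/existsP => v /existsP[i /andP[/eqP uE /eqP c'E]].
  split=> [[<-]|[w [j [jw uE' ->]]]]; first by exists v, i.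
  have vw : v = w by apply: (dis v w i j) => //; rewrite -uE.
  rewrite c'E -vw; rewrite -vw in jw uE'; congr (Some (iter _.-1 _ _)).
  apply: iter_parent_inj (etrans (esym uE) uE'); last exact: ltnW (leq_trans jw (fl v)).
  exact: ltnW (leq_trans (ltn_ord i) (fl v)).
split=> // -[v [i [iv uE cE]]]; have /existsP[] := none c.
by exists v; apply/existsP; exists (Ordinal iv); rewrite uE cE !eqxx.
Qed.

Lemma selectorsP (h : {ffun V -> option V}) :
  reflect (h r = None /\ forall u c, h u = Some c ->
      if u \in leaves T then c = u else c \in children T u /\ h c)
    (h \in selectors T).
Proof.
rewrite inE; apply: (iffP andP) => [[/eqP hr /'forall_forallP hP]|[hr hP]].
  split=> // u c /eqP huc; have := hP u c; rewrite huc /= /candidates.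
  by case: ifP => _; [move/set1P | rewrite in_setI => /andP[cu]; rewrite inE].
split; first exact/eqP.
apply/'forall_forallP => u c; apply/implyP => /eqP /hP; rewrite /candidates.
case: ifP => _ => [->|[cu hc]]; first by rewrite set11.
by rewrite in_setI cu inE hc.
Qed.

(** Two paths sharing an edge arrive there through the same selected child. Tracing them back
    reaches a leaf, where both must start. *)
Lemma collection_of_edge_disjoint h :
  h \in selectors T -> collection_of h \in edge_disjoint_collections T.
Proof.
case/selectorsP => hr hP; apply/edge_disjointP; split=> [v|v|v w].
- by rewrite collection_ofE size_traject.
- by rewrite collection_ofE size_traject steps_le.
have leaf0 (x y : leaf) i : i < steps h (val y) -> val x = iter i par (val y) -> x = y.
  move=> iy xy; apply: val_inj; rewrite xy; have xl := valP x; rewrite /= xy in xl.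
  by rewrite (iter_parent_leaf _ xl) // ltnW // (leq_trans iy) ?steps_le.
rewrite !collection_ofE !size_traject.
elim=> [|i IH] [|j] iv jw vw; rewrite /= in vw.
- exact: leaf0 jw _.
- exact: leaf0 jw _.
- exact: esym (leaf0 _ _ _ iv (esym vw)).
have := (ltn_stepsP _ _ hr iv _ (leqnn _)); rewrite /= vw.
have -> := (ltn_stepsP _ _ hr jw _ (leqnn _)) => -[ji].
by apply: (IH j); rewrite ?ji ?(ltnW iv) ?(ltnW jw).
Qed.

(** A path using the edge above an internal vertex has just used the edge above the child it came
    through. *)
Lemma selector_of_selectors f :
  f \in edge_disjoint_collections T -> selector_of f \in selectors T.
Proof.
move=> fT; have [fE fl dis] := edge_disjointP _ fT; apply/selectorsP; split.
  case E: (selector_of f r) => [c|//].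
  have [v [i [iv ri _]]] := (selector_ofP _ _ fT).1 E.
  by have := iter_parent_neq_root (leq_trans iv (fl v)); rewrite -ri eqxx.
move=> u c /(selector_ofP _ _ fT)[v [[|i] [iv -> ->]]].
  by rewrite /= (valP v).
have iv' := leq_trans iv (fl v).
case: ifP => [/(iter_parent_leaf (ltnW iv'))//|_]; split.
  by rewrite /= children_parent iter_parent_neq_root ?eqxx // ltnW.
have -> // : selector_of f (iter i.+1.-1 par (val v)) = Some (iter i.-1 par (val v)).
by apply/selector_ofP => //; exists v, i; split=> //; apply: ltnW.
Qed.

Lemma selector_ofK :
  {in edge_disjoint_collections T, cancel selector_of collection_of}.
Proof.
move=> f fT; have [fE fl dis] := edge_disjointP _ fT.
have /selectorsP[hr _] := selector_of_selectors fT.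
apply/ffunP => v; apply: val_inj; rewrite /= collection_ofE fE.
congr traject; apply/eqP; rewrite eqn_leq; apply/andP; split; last first.
  case E: (size (f v)) => [//|k]; apply/ltn_stepsP => // j jk.
  by apply/selector_ofP => //; exists v, j; rewrite E ltnS.
(* If the rebuilt path were longer, some path of [f], from [w], would use the edge above the end of
   the path of [v] and arrive from the same vertex. Leaves occur only as starts, so disjointness
   gives [v = w], and that path exceeds its own length. *)
rewrite leqNgt; apply/negP => /(ltn_stepsP _ _ hr)/(_ _ (leqnn _)).
case/(selector_ofP _ _ fT) => w [j [jw vw vw']].
have jlw := leq_trans jw (fl w).
case: j => [|j] in jw vw vw' jlw *.
  have wl := valP w; rewrite /= in vw; rewrite /= -vw in wl.
  have k0 := iter_parent_leaf (fl v) wl.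
  by rewrite k0 /= in vw; move: jw; rewrite -(val_inj vw) k0.
case E: (size (f v)) vw vw' => [|k] /= vw vw'.
  have vl := valP v; rewrite /= vw in vl.
  by have := iter_parent_leaf (i := j.+1) (ltnW jlw) vl.
have vwE : v = w by apply: (dis v w k j); rewrite ?E // ltnW.
move: jw; rewrite -vwE -(@iter_parent_inj (size (f v)) j.+1 (val v)) ?ltnn //.
- by rewrite vwE ltnW.
- by rewrite E /= vw vwE.
Qed.

Lemma collection_ofK : {in selectors T, cancel collection_of selector_of}.
Proof.
move=> h hS; have /selectorsP[hr hP] := hS.
have cT := collection_of_edge_disjoint hS.
have sound u c : selector_of (collection_of h) u = Some c -> h u = Some c.
  move/(selector_ofP _ _ cT) => [v [i [iv -> ->]]].
  rewrite collection_ofE size_traject in iv.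
  exact: (ltn_stepsP _ _ hr iv).
(* Selected children are followed down to a leaf, whose path then climbs back through [u]; the
   induction is on the remaining depth. *)
have complete u c : h u = Some c -> exists (v : leaf) i,
    [/\ i < steps h (val v), u = iter i par (val v) & c = iter i.-1 par (val v)].
  have [m] := ubnP (#|V| - level u); elim: m u c => // m IH u c um huc.
  have := hP _ _ huc; case: ifP => [ul cu|_ [cu]].
    exists (exist _ u ul), 0; split=> //=.
    by apply/ltn_stepsP => // -[|//] _ /=; rewrite huc cu.
  case hc: (h c) => [c'|//] _.
  have lc : level c = (level u).+1 by move: cu; rewrite inE => /andP[_ /eqP].
  have [|v [i [iv cE c'E]]] := IH _ _ _ hc.
    by rewrite lc -ltnS (leq_trans _ um) // ltnS ltn_sub2l // -lc level_le_card.
  have uE : u = par c by move: cu; rewrite children_parent => /andP[_ /eqP].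
  exists v, i.+1; split=> //=; last by rewrite uE cE.
  apply/ltn_stepsP => // j; rewrite leq_eqVlt => /predU1P[->|].
    by rewrite /= -cE -uE.
  by rewrite ltnS; apply/ltn_stepsP.
apply/ffunP => u; case E: (selector_of _ u) => [c|]; first by rewrite (sound _ _ E).
case hu: (h u) => [c|//]; have [v [i [iv uE cE]]] := complete _ _ hu.
rewrite -E; apply/(selector_ofP _ _ cT); exists v, i; split=> //.
by rewrite collection_ofE size_traject.
Qed.

Lemma card_edge_disjoint_collections :
  #|edge_disjoint_collections T| = #|selectors T|.
Proof.
exact: card_eq_can_in selector_of_selectors collection_of_edge_disjoint
  selector_ofK collection_ofK.
Qed.
End Collections.

(** * The determinant formulas and the count of collections *)

Local Open Scope ring_scope.

Theorem theorem3p3 (R : realType) (V : finType) (T : rooted_tree V)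
    (d : nat) (hd : (2 <= d)%N) (hT : d_ary T d)
    (n : nat) (v : n.-tuple V) (v_uniq : uniq v) (v_leaves : v =i leaves T) :
  [/\ \det (((d%:R - 1)^-1)%:M + ancestral_mx T R v)
        = (-1) ^+ n * (char_poly (ancestral_mx T R v)).[- (d%:R - 1)^-1],
      (-1) ^+ n * (char_poly (ancestral_mx T R v)).[- (d%:R - 1)^-1]
        = (d%:R - 1) ^- n * d%:R `^ (d%:R * (n%:R - 1) / (d%:R - 1)),
      \det (1%:M + (d%:R - 1) *: ancestral_mx T R v)
        = d%:R ^+ (d * #|internals T|)
    & d = 2%N -> #|edge_disjoint_collections T| = (4 ^ (n - 1))%N].
Proof.
have nE : n = #|leaves T|.
  by rewrite -(eq_card v_leaves) (card_uniqP v_uniq) size_tuple.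
have d_gt0 : (0 < d)%N by apply: ltnW.
have n_internals : n.-1 = (d.-1 * #|internals T|)%N by rewrite nE; apply: card_leaves.
have d_neq0 : d%:R != 0 :> R by rewrite pnatr_eq0 -lt0n.
have dB1 : d%:R - 1 = d.-1%:R :> R by rewrite -subn1 natrB.
have dB1_neq0 : d%:R - 1 != 0 :> R by rewrite dB1 pnatr_eq0 -lt0n -ltnS prednK.
have det_scaled : \det (1%:M + (d%:R - 1) *: ancestral_mx T R v)
    = d%:R ^+ (d * #|internals T|).
  by rewrite (det_ancestral_mx v_uniq v_leaves hT d_neq0) (card_vertices hT).
have char_polyE : \det (((d%:R - 1)^-1)%:M + ancestral_mx T R v)
    = (-1) ^+ n * (char_poly (ancestral_mx T R v)).[- (d%:R - 1)^-1].
  by rewrite horner_char_poly -detZ scaleN1r opprB raddfN /= opprK addrC.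
split=> // [|d2]; last first.
  rewrite d2 in hT n_internals.
  by rewrite card_edge_disjoint_collections (card_selectors hT) subn1 n_internals mul1n.
(* Since [n - 1] is [d - 1] times the number of internal vertices, the real exponent is a natural
   number. *)
have -> : d%:R * (n%:R - 1) / (d%:R - 1) = (d * #|internals T|)%:R :> R.
  have -> : n%:R - 1 = n.-1%:R :> R by rewrite -subn1 natrB // nE leaves_gt0.
  by rewrite n_internals !natrM -dB1; field.
(* Scaling the matrix of size [n] by the inverse of [d - 1] accounts for the power [(d - 1)^-n]. *)
rewrite powR_mulrn // -det_scaled -char_polyE -[_ ^- n]exprVn -detZ.
by rewrite scalerDr scalerA mulVf // scale1r scalemx1.
Qed.
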